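(* Let $\zeta\in\mathbb{C}$ be a primitive third root of unity and let $x_0,x_1,x_2,x_3$ be homogeneous coordinates on $\mathbb{P}^3_{\mathbb{C}}$. Consider the hyperplane arrangement $$\mathcal{A}_{\mu_3}=\{\,x_i-\zeta^a x_j=0 \;\mid\; i\in\{0,1\},\ j\in\{2,3\},\ a\in\mathbb{Z}/3\mathbb{Z}\,\}\subset\mathbb{P}^3_{\mathbb{C}}.$$ Then $\mathcal{A}_{\mu_3}$ is an essential arrangement of $12$ hyperplanes, and $$\ell(\mathcal{A}_{\mu_3})=58,\qquad p(\mathcal{A}_{\mu_3})=43.$$ Consequently, $$p(\mathcal{A}_{\mu_3})-\ell(\mathcal{A}_{\mu_3})+12+2=-1.$$ In particular, Purdy's inequality fails for $\mathcal{A}_{\mu_3}$.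
   Context: Let $\mathcal{A}=\{H_1,\dots,H_n\}$ be an arrangement of $n$ distinct hyperplanes (projective planes) in $\mathbb{P}^3_{\mathbb{C}}$. - $\ell(\mathcal{A})$ is the number of distinct intersection lines, i.e. distinct lines of the form $H_i\cap H_j$ with $i\neq j$. - $p(\mathcal{A})$ is the number of distinct intersection points, i.e. distinct points $x\in\mathbb{P}^3_{\mathbb{C}}$ such that $\{x\}=H_i\cap H_j\cap H_k$ for some three hyperplanes of $\mathcal{A}$ (equivalently, three hyperplanes of $\mathcal{A}$ whose defining linear forms are linearly independent meet at $x$). - $\mathcal{A}$ is essential if the linear forms defining its hyperplanes span the full 4-dimensional dual vector space $(\mathbb{C}^4)^\vee$. - Purdy's inequality for $\mathcal{A}$ is the inequality $p(\mathcal{A})-\ell(\mathcal{A})+n+2\geq 0$. *)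

(* Defs.v *)
From HB Require Import structures.
From mathcomp Require Import all_boot all_order all_algebra.
From mathcomp Require Import finmap.
From mathcomp Require Import all_classical reals.
From mathcomp Require Export complex.

Set Implicit Arguments.
Unset Strict Implicit.
Unset Printing Implicit Defensive.

Import GRing.Theory Num.Theory.

Local Open Scope classical_set_scope.
Local Open Scope ring_scope.

(* P^3(F): the lines through the origin of F^4. *)
Definition proj3 (F : fieldType) : Type :=
  {x : {vspace 'rV[F]_4} | \dim x == 1%N}.

Definition dual4 (F : fieldType) : vectType F := 'Hom('rV[F]_4, F^o).

Definition homcoord (F : fieldType) (i : 'I_4) : dual4 F :=
  linfun (fun v : 'rV[F]_4 => v 0 i : F^o).

Definition zeros (F : fieldType) (f : dual4 F) : set (proj3 F) :=
  [set x | (val x <= lker f)%VS].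

Definition defines (F : fieldType) (f : dual4 F) (H : set (proj3 F)) : Prop :=
  f != 0 /\ H = zeros f.

Definition is_arrangement (F : fieldType) (A : set (set (proj3 F))) : Prop :=
  finite_set A /\ (forall H, A H -> exists f, defines f H).

(* The linear span of the (infinite) set of all forms defining a member of A
   is the whole dual space. *)
Definition essential (F : fieldType) (A : set (set (proj3 F))) : Prop :=
  forall g : dual4 F, exists s : seq (dual4 F),
    (forall f, f \in s -> exists H, A H /\ defines f H) /\ g \in <<s>>%VS.

(* Number of elements of a finite set (0 if the set is infinite; an arrangement
   is finite, hence so are its sets of intersection lines and points). *)
Definition card_set (T : choiceType) (S : set T) : nat := #|` fset_set S|.

Definition intersection_lines (F : fieldType) (A : set (set (proj3 F))) :
    set (set (proj3 F)) :=
  [set L | exists H K, [/\ A H, A K, H <> K & L = H `&` K]].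

Definition intersection_points (F : fieldType) (A : set (set (proj3 F))) :
    set (proj3 F) :=
  [set x | exists H K L, [/\ A H, A K, A L & [set x] = H `&` K `&` L]].

Definition num_planes (F : fieldType) (A : set (set (proj3 F))) : nat :=
  card_set A.

Definition num_lines (F : fieldType) (A : set (set (proj3 F))) : nat :=
  card_set (intersection_lines A).

Definition num_points (F : fieldType) (A : set (set (proj3 F))) : nat :=
  card_set (intersection_points A).

Definition purdy_inequality (F : fieldType) (A : set (set (proj3 F))) : Prop :=
  (num_points A)%:Z - (num_lines A)%:Z + (num_planes A)%:Z + 2 >= 0.

(* The planes x_i - zeta^a x_j = 0 for i in {0, 1}, j in {2, 3}, a in Z/3;
   zeta ^+ a uses the representative of a in {0, 1, 2}. *)
Definition arr_mu3 (F : fieldType) (zeta : F) : set (set (proj3 F)) :=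
  [set H | exists (i j : 'I_4) (a : 'Z_3),
     [/\ (i < 2)%N, (2 <= j)%N &
         H = zeros (homcoord F i - zeta ^+ a *: homcoord F j)]].

(* Main.v *)
(* Every intersection point of the arrangement has homogeneous coordinates in
   {0} \cup mu_3, and incidence of such a point with a plane x_i = zeta^a x_j is
   a computation modulo 3. The 43 points are 27 with four nonzero coordinates,
   12 with exactly two (one from {x_0, x_1}, one from {x_2, x_3}) and 4 with one.
   Any three planes share one of these points, so no other point can be an
   intersection point; conversely each of them is cut out by three planes, as
   one sees by propagating v_i = c v_k along the planes from a nonzero v_k, where
   two planes with the same axes i, j force v_i = v_j = 0. Planes and lines are
   told apart by which of the 43 points they contain, points by which planes
   contain them. The 66 pairs of planes give 58 lines because the three planes
   with given i, j form a pencil, for each of the four choices of (i, j). *)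
Require Import Defs.
From HB Require Import structures.
From mathcomp Require Import all_boot all_order all_algebra.
From mathcomp Require Import finmap.
From mathcomp Require Import all_classical reals.
Import GRing.Theory Num.Theory.

(** * Counting a set through separating signatures *)

Lemma uniq_map_inj (I J : eqType) (f : I -> J) (s : seq I) :
  uniq (map f s) -> {in s &, injective f}.
Proof.
move=> us x y sx sy fxy; rewrite -[x](nth_index x sx) -[y](nth_index x sy).
congr nth; apply/eqP; rewrite -(nth_uniq (f x) _ _ us) ?size_map ?index_mem//.
by rewrite !(nth_map x) ?index_mem// !nth_index// fxy.
Qed.

Lemma set_fset_map (I : eqType) (T : choiceType) (S : set T) (s : seq I) (f : I -> T) :
  (forall x, S x <-> exists2 i, i \in s & x = f i) ->
  S = [set` [fset x in map f s]%fset]%classic.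
Proof.
move=> Ss; apply/seteqP; split=> x /=; rewrite !inE.
  by case/Ss=> i si ->; exact: map_f.
by case/mapP=> i si ->; apply/Ss; exists i.
Qed.

(** Injectivity of [f] on [s] is not assumed but deduced: the signature [g] depends only on the
    value of [f] there and takes distinct values along [s], so the enumeration has no repetition. *)
Lemma card_set_seq (I : eqType) (J T : choiceType) (S : set T) (s : seq I)
    (f : I -> T) (g : I -> J) :
    (forall x, S x <-> exists2 i, i \in s & x = f i) ->
    (forall i j, i \in s -> j \in s -> f i = f j -> g i = g j) ->
  uniq (map g s) -> card_set S = size s.
Proof.
move=> Ss fg ug; rewrite /card_set (set_fset_map _ _ _ _ _ Ss) set_fsetK card_fseq.
rewrite undup_id ?size_map// map_inj_in_uniq.
  exact: map_uniq ug.
move=> i j si sj /(fg _ _ si sj); exact: uniq_map_inj ug _ _ si sj.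
Qed.

(** * Combinatorial model with exponents modulo 3 *)

(* Vectors with entries in {0} \cup mu_3 are encoded by sequences of entries
   [None] (for 0) and [Some a] (for zeta ^+ a), and the plane
   x_i = zeta ^+ a x_j by the triple (i, j, a). *)
Definition entry := option nat.
Definition plane_code : Type := nat * nat * nat.

Definition scale_entry (a : nat) : entry -> entry :=
  omap (fun b => (a + b) %% 3)%N.
Definition same_entry (c d : entry) : bool :=
  omap (modn^~ 3) c == omap (modn^~ 3) d.
Definition incident (p : plane_code) (s : seq entry) : bool :=
  same_entry (nth None s p.1.1) (scale_entry p.2 (nth None s p.1.2)).

Definition planes : seq plane_code :=
  [seq (ij, a) | ij <- [:: (0, 2); (0, 3); (1, 2); (1, 3)], a <- iota 0 3].

(* Three planes x_i = zeta ^+ a x_j with the same i, j meet in the line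
   x_i = x_j = 0; the other pairs of planes meet in pairwise distinct lines. *)
Definition line_code (p q : plane_code) : plane_code * plane_code :=
  if p.1 == q.1 then ((p.1, 0), (p.1, 1))
  else if (index p planes < index q planes)%N then (p, q) else (q, p).
Definition lines : seq (plane_code * plane_code) :=
  undup [seq line_code pq.1 pq.2 | pq <- [seq pq <- allpairs pair planes planes
                                         | pq.1 != pq.2]].

(** Each projective point is normalised to have some coordinate 1. In the second block, the point
    with x_i = zeta^a, x_j = 1 and zeros elsewhere is indexed by the plane (i, j, a). *)
Definition points : seq (seq entry) :=
  [seq [:: Some 0; Some ab.1; Some ab.2; Some c]
     | ab <- allpairs pair (iota 0 3) (iota 0 3), c <- iota 0 3]
  ++ [seq [seq if k == p.1.2 then Some 0
               else if k == p.1.1 then Some p.2 else None | k <- iota 0 4]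
     | p <- planes]
  ++ [seq [seq if k == i then Some 0 else None | k <- iota 0 4] | i <- iota 0 4].

(* A fact (i, c) stands for the equation v_i = c v_k, where k is fixed. *)
Definition zero_facts (ps : seq plane_code) : seq (nat * entry) :=
  flatten [seq [:: (pq.1.1.1, None); (pq.1.1.2, None)]
    | pq <- [seq pq <- allpairs pair ps ps
            | (pq.1.1 == pq.2.1) && ~~ same_entry (Some pq.1.2) (Some pq.2.2)]].
(** The last batch reads a plane backwards, as v_j = zeta^(2a) v_i, which is legitimate because
    zeta^3 = 1. *)
Definition propagate ps (env : seq (nat * entry)) :=
  undup (env ++
  [seq (pf.1.1.1, scale_entry pf.1.2 pf.2.2)
    | pf <- [seq pf <- allpairs pair ps env | pf.2.1 == pf.1.1.2]] ++
  [seq (pf.1.1.2, scale_entry (2 * pf.1.2) pf.2.2)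
    | pf <- [seq pf <- allpairs pair ps env | pf.2.1 == pf.1.1.1]]).
(** Three planes link coordinates in chains of at most three steps, whence three rounds. *)
Definition facts k ps := iter 3 (propagate ps) ((k, Some 0) :: zero_facts ps).
(** For a listed point, [index (Some 0) s] is the position k of a coordinate 1, so the facts v_i =
    s_i v_k for all i make v the multiple by v_k of the vector of [s]. *)
Definition determines (ps : seq plane_code) (s : seq entry) : bool :=
  let fs := facts (index (Some 0) s) ps in
  all (fun i => has (fun f => (f.1 == i) && same_entry f.2 (nth None s i)) fs)
    (iota 0 4).

(** * Finite checks by computation *)

Lemma size_lines : size lines = 58. Proof. by vm_compute. Qed.
Lemma size_points : size points = 43. Proof. by vm_compute. Qed.

Lemma planes_separated : uniq [seq [seq incident p s | s <- points] | p <- planes].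
Proof. by vm_compute. Qed.

Lemma lines_separated :
  uniq [seq [seq incident t.1 s && incident t.2 s | s <- points] | t <- lines].
Proof. by vm_compute. Qed.

Lemma points_separated :
  uniq [seq [seq incident p s | p <- planes] | s <- points].
Proof. by vm_compute. Qed.

Lemma plane_bounds p : p \in planes -> [/\ p.1.1 < 2, 2 <= p.1.2 < 4 & p.2 < 3]%N.
Proof.
have : all (fun p => [&& p.1.1 < 2, 2 <= p.1.2 < 4 & p.2 < 3]%N) planes.
  by vm_compute.
by move=> /allP H /H /and3P.
Qed.

Lemma points_nonzero s : s \in points ->
  has (fun i => nth None s i != None) (iota 0 4).
Proof.
suff /allP : all (fun s => has (fun i => nth None s i != None) (iota 0 4)) points.
  exact.
by vm_compute.
Qed.

Lemma lines_planes t : t \in lines ->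
  [/\ t.1 \in planes, t.2 \in planes & t.1 != t.2].
Proof.
have : all (fun t => [&& t.1 \in planes, t.2 \in planes & t.1 != t.2]) lines.
  by vm_compute.
by move=> /allP H /H /and3P.
Qed.

Lemma points_meet_planes p q r :
  p \in planes -> q \in planes -> r \in planes ->
  exists2 s, s \in points & [&& incident p s, incident q s & incident r s].
Proof.
have : all (fun p => all (fun q => all (fun r => has (fun s =>
  [&& incident p s, incident q s & incident r s]) points) planes) planes) planes.
  by vm_compute.
by move=> /allP H /H{H} /allP H /H{H} /allP H /H{H} /hasP.
Qed.

Lemma points_determined s : s \in points -> exists p q r,
  [/\ p \in planes, q \in planes, r \in planes,
      all (incident^~ s) [:: p; q; r] & determines [:: p; q; r] s].
Proof.
have : all (fun s => let ps := [seq p <- planes | incident p s] in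
  has (fun p => has (fun q => has (fun r => determines [:: p; q; r] s) ps) ps) ps)
  points by vm_compute.
move=> /allP H /H{H} /hasP[p + /hasP[q + /hasP[r]]]; rewrite !mem_filter.
move=> /andP[ps pP] /andP[qs qP] /andP[rs rP] det; exists p, q, r.
by rewrite /= rs qs ps.
Qed.

Local Open Scope ring_scope.
Local Open Scope complex_scope.

(** * Projective points and linear forms in coordinates *)

Section ProjectiveSpace.
Variable F : fieldType.
Implicit Types (v w : 'rV[F]_4) (x : proj3 F).

Definition coordinate (i : 'I_4) v : F^o := v 0 i.

Fact coordinate_is_linear i : linear (coordinate i).
Proof. by move=> a v w; rewrite /coordinate !mxE. Qed.

HB.instance Definition _ i := GRing.isLinear.Build F 'rV[F]_4 F^o *:%R
  (coordinate i) (coordinate_is_linear i).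

Lemma homcoordE i v : homcoord F i v = v 0 i.
Proof. by rewrite -[homcoord F i]/(linfun (coordinate i)) lfunE. Qed.

Fact vline_delta_dim1 : \dim <[delta_mx 0 0 : 'rV[F]_4]> == 1%N.
Proof.
rewrite dim_vline eqb1; apply/eqP => /matrixP/(_ 0 0)/eqP.
by rewrite !mxE oner_eq0.
Qed.

(* Junk value: [point 0] is the first coordinate point. *)
Definition point v : proj3 F := 
  insubd (exist (fun U : {vspace _} => \dim U == 1%N) _ vline_delta_dim1) <[v]>%VS.

Lemma val_point v : v != 0 -> val (point v) = <[v]>%VS.
Proof. by move=> v0; rewrite insubdK// -topredE /= dim_vline v0. Qed.

Lemma pointP x : exists2 v, v != 0 & x = point v.
Proof.
case: x => U /= dimU; have vn0 : vpick U != 0.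
  by rewrite vpick0 -dimv_eq0 (eqP dimU).
exists (vpick U) => //; apply: val_inj; rewrite val_point//=; apply/esym/eqP.
by rewrite eqEdim -memvE memv_pick (eqP dimU) dim_vline vn0.
Qed.

Lemma pointZ c v : c *: v != 0 -> point (c *: v) = point v.
Proof.
move=> cv0; have v0 : v != 0 by apply: contraNneq cv0 => ->; rewrite scaler0.
apply: val_inj; rewrite !val_point//; apply/eqP.
by rewrite eqEdim -memvE memvZ ?memv_line// !dim_vline v0 cv0.
Qed.

Lemma zeros_point f v : v != 0 -> zeros f (point v) <-> f v = 0.
Proof.
move=> v0; rewrite /zeros /mkset val_point// -memvE memv_ker.
by split => [/eqP|->].
Qed.

(** The coordinate forms are dual to the standard basis, so [g] is their combination with
    coefficients g(e_i). *)
Lemma homcoord_span (S : {vspace dual4 F}) :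
  (forall i, homcoord F i \in S) -> S = fullv.
Proof.
move=> hS; apply/eqP; rewrite eqEsubv subvf; apply/subvP => g _.
suff -> : g = \sum_i g (delta_mx 0 i) *: homcoord F i.
  by apply: memv_suml => i _; apply: memvZ.
apply/lfunP => v; rewrite {1}(row_sum_delta v) linear_sum sum_lfunE.
apply: eq_bigr => i _; rewrite linearZ /= scale_lfunE homcoordE.
by rewrite /GRing.scale /= mulrC.
Qed.

End ProjectiveSpace.
Arguments point {F}.

(** * Realising the model over a field with a primitive cube root of unity *)

Section ConcreteArrangement.
Variables (F : fieldType) (zeta : F).
Hypothesis zeta3 : 3.-primitive_root zeta.
Implicit Types (v : 'rV[F]_4) (p q : plane_code) (s : seq entry).

Definition entry_val (c : entry) : F := if c is Some a then zeta ^+ a else 0.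
Definition vec s : 'rV[F]_4 := \row_i entry_val (nth None s i).
Definition form p : dual4 F :=
  homcoord F (inord p.1.1) - zeta ^+ p.2 *: homcoord F (inord p.1.2).
Definition plane p : set (proj3 F) := zeros (form p).

Lemma entry_val_scale a c : entry_val (scale_entry a c) = zeta ^+ a * entry_val c.
Proof. by case: c => [b|] /=; rewrite ?(prim_expr_mod zeta3) ?exprD ?mulr0. Qed.

Lemma zeta_neq0 : zeta != 0.
Proof.
apply/eqP => z0; move: (prim_expr_order zeta3) => /eqP.
by rewrite z0 expr0n eq_sym oner_eq0.
Qed.

(** Powers of a primitive cube root of unity agree exactly when the exponents agree modulo 3, and
    none of them is 0. *)
Lemma entry_val_eq c d : (entry_val c == entry_val d) = same_entry c d.
Proof.
case: c d => [a|] [b|] /=; rewrite /same_entry /= ?eqxx//.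
- by rewrite (eq_prim_root_expr zeta3).
- by rewrite expf_eq0 (negPf zeta_neq0) andbF.
- by rewrite eq_sym expf_eq0 (negPf zeta_neq0) andbF.
Qed.

Lemma formE p v : (form p v == 0) =
  (v 0 (inord p.1.1) == zeta ^+ p.2 * v 0 (inord p.1.2)).
Proof. by rewrite /form add_lfunE opp_lfunE scale_lfunE !homcoordE subr_eq0. Qed.

Lemma vec_neq0 s : s \in points -> vec s != 0.
Proof.
move=> sP; have /hasP[k] := points_nonzero _ sP; rewrite mem_iota /= => k4.
apply: contraNneq => /rowP/(_ (Ordinal k4)); rewrite !mxE /= => /eqP.
by rewrite -[0]/(entry_val None) entry_val_eq /same_entry; case: nth.
Qed.

Lemma plane_vec p s : p \in planes -> s \in points ->
  plane p (point (vec s)) <-> incident p s.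
Proof.
move=> /plane_bounds[i2 /andP[_ j4] _] sP; rewrite /plane zeros_point ?vec_neq0//.
rewrite (rwP eqP) formE !mxE !inordK//; last exact: leq_trans i2 _.
by rewrite -entry_val_scale entry_val_eq.
Qed.

Lemma arr_mu3E H : arr_mu3 zeta H <-> exists2 p, p \in planes & H = plane p.
Proof.
split=> [[i [j [a [i2 j2 ->]]]]|[p /plane_bounds[i2 /andP[j2 j4] a3] ->]].
  exists (i : nat, j : nat, a : nat); last by rewrite /plane /form /= !inord_val.
  by move: i j a i2 j2 => [[|[|i]] ?] [[|[|[|[|j]]]] ?] [[|[|[|a]]] ?].
exists (inord p.1.1), (inord p.1.2), (inord p.2).
have i4 : (p.1.1 < 4)%N by exact: leq_trans i2 _.
by split; rewrite /= ?inordK.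
Qed.

Lemma plane_signature p q : p \in planes -> q \in planes -> plane p = plane q ->
  [seq incident p s | s <- points] = [seq incident q s | s <- points].
Proof.
move=> pP qP pq; apply/eq_in_map => s sP.
by apply/idP/idP => /plane_vec; [rewrite pq|rewrite -pq] => H;
  apply/plane_vec => //; exact: H.
Qed.

Lemma plane_inj p q : p \in planes -> q \in planes -> plane p = plane q -> p = q.
Proof.
move=> pP qP /(plane_signature _ _ pP qP).
exact: uniq_map_inj planes_separated _ _ pP qP.
Qed.

Lemma form_neq0 p : p \in planes -> form p != 0.
Proof.
move=> /plane_bounds[i2 /andP[j2 j4] _].
(* The form takes the value 1 at the basis vector e_i, since i < 2 <= j. *)
apply/eqP => /lfunP/(_ (delta_mx 0 (inord p.1.1)))/eqP; rewrite zero_lfunE formE.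
have i4 : (p.1.1 < 4)%N by exact: leq_trans i2 _.
have ji : (inord p.1.2 == inord p.1.1 :> 'I_4) = false.
  by rewrite -val_eqE /= !inordK// gtn_eqF// (leq_trans i2).
by rewrite !mxE !eqxx ji mulr0 oner_eq0.
Qed.

(** * Soundness of the deduction of equations *)

Lemma zero_facts_sound k ps v : all (fun p => form p v == 0) ps ->
  forall f, f \in zero_facts ps ->
  v 0 (inord f.1) = entry_val f.2 * v 0 (inord k).
Proof.
move=> /allP psv f /flatten_mapP[[p q]]; rewrite mem_filter /=.
move=> /andP[/andP[/eqP pq1 pq2] /allpairsP[[p' q'] /= [pP qP [? ?]]]]; subst p' q'.
(* From v_i = zeta^a v_j = zeta^b v_j follows (zeta^a - zeta^b) v_j = 0 with a nonzero factor, so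
   v_j = 0 and then v_i = 0. *)
have := psv _ qP; have := psv _ pP; rewrite !formE -pq1 => /eqP vi.
rewrite {1}vi -subr_eq0 -mulrBl mulf_eq0 subr_eq0.
rewrite -[_ == _]/(entry_val (Some _) == entry_val (Some _)) entry_val_eq.
rewrite (negPf pq2) /= => /eqP vj; rewrite vj mulr0 in vi.
by rewrite !inE => /orP[] /eqP -> /=; rewrite mul0r.
Qed.

Lemma propagate_sound k ps v env : all (fun p => form p v == 0) ps ->
  (forall f, f \in env -> v 0 (inord f.1) = entry_val f.2 * v 0 (inord k)) ->
  forall f, f \in propagate ps env ->
  v 0 (inord f.1) = entry_val f.2 * v 0 (inord k).
Proof.
move=> /allP psv envP f; rewrite mem_undup !mem_cat => /or3P[/envP//| |] /mapP[[p g]];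
  rewrite mem_filter /= => /andP[/eqP gp /allpairsP[[p' g'] /= [pP gP [? ?]]]] ->;
  subst p' g'; have := psv _ pP; rewrite formE /= entry_val_scale -mulrA => /eqP.
  by rewrite -(envP _ gP) gp.
rewrite -(envP _ gP) gp => ->; rewrite mulrA -exprD.
by rewrite -[X in (_ + X)%N]mul1n -mulnDl exprM (prim_expr_order zeta3) expr1n mul1r.
Qed.

Lemma determines_sound ps s v : determines ps s ->
  all (fun p => form p v == 0) ps -> exists c, v = c *: vec s.
Proof.
rewrite /determines; set k := index _ _ => /allP ks psv.
exists (v 0 (inord k)); apply/rowP => i.
have := ks i; rewrite mem_iota ltn_ord => /(_ isT)/hasP[f fP /andP[/eqP fi]].
rewrite -entry_val_eq !mxE => /eqP <-; rewrite mulrC.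
rewrite -[i in LHS]inord_val -fi; move: f fP {fi}; rewrite /facts.
do 3!apply: propagate_sound => //; move=> f; rewrite inE => /orP[/eqP -> /=|].
  by rewrite mul1r.
exact: zero_facts_sound.
Qed.

(** * Intersection points and intersection lines *)

Lemma plane_meet_points p q r : p \in planes -> q \in planes -> r \in planes ->
  forall x, [set x]%classic = (plane p `&` plane q `&` plane r)%classic ->
  exists2 s, s \in points & x = point (vec s).
Proof.
move=> pP qP rP x xE; have [s sP /and3P[ps qs rs]] := points_meet_planes _ _ _ pP qP rP.
exists s => //; apply/esym; have : [set x]%classic (point (vec s)); last exact.
by rewrite xE; split; first split; apply/plane_vec.
Qed.

Lemma intersection_pointsE x : intersection_points (arr_mu3 zeta) x <->
  exists2 s, s \in points & x = point (vec s).
Proof.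
split=> [[H [K [L [/arr_mu3E[p pP ->] /arr_mu3E[q qP ->] /arr_mu3E[r rP ->]]]]]|].
  exact: plane_meet_points.
move=> [s sP ->]; have [p [q [r [pP qP rP /and4P[ps qs rs _] det]]]] :=
  points_determined _ sP.
exists (plane p), (plane q), (plane r).
split; try by apply/arr_mu3E; eexists; last reflexivity.
apply/seteqP; split=> [_ ->|y].
  by split; first split; apply/plane_vec.
have [v v0 ->] := pointP _ y.
move=> [[/(zeros_point _ _ _ v0) pv /(zeros_point _ _ _ v0) qv]].
move=> /(zeros_point _ _ _ v0) rv /=.
(* A multiple of the vector of [s] represents the same projective point. *)
have [|c vE] := determines_sound _ _ v det; first by rewrite /= pv qv rv eqxx.
by rewrite vE pointZ// -vE.
Qed.

(** Two distinct planes of a pencil already force v_i = v_j = 0, which satisfies every equation of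
    that pencil. *)
Lemma plane_same_axes ij a b c d : (a != b %[mod 3])%N ->
  (plane (ij, a) `&` plane (ij, b) `<=` plane (ij, c) `&` plane (ij, d))%classic.
Proof.
move=> ab x; have [v v0 ->] := pointP _ x.
move=> [/(zeros_point _ _ _ v0)/eqP + /(zeros_point _ _ _ v0)/eqP].
rewrite !formE /= => /eqP vi; rewrite vi -subr_eq0 -mulrBl mulf_eq0 subr_eq0.
rewrite (eq_prim_root_expr zeta3) (negPf ab) /= => /eqP vj.
by split; apply/zeros_point => //; apply/eqP; rewrite formE /= vi vj !mulr0.
Qed.

Lemma line_vec t s : t \in lines -> s \in points ->
  (plane t.1 `&` plane t.2)%classic (point (vec s)) <->
  incident t.1 s && incident t.2 s.
Proof.
move=> /lines_planes[t1 t2 _] sP; rewrite -(rwP andP).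
by rewrite -(plane_vec _ _ t1 sP) -(plane_vec _ _ t2 sP).
Qed.

Lemma line_codeE p q : p \in planes -> q \in planes -> p != q ->
  (plane p `&` plane q)%classic =
  (plane (line_code p q).1 `&` plane (line_code p q).2)%classic.
Proof.
case: p q => [ij a] [kl b] pP qP; rewrite /line_code /=.
have [ijkl|_ _] := eqVneq ij kl; last by case: ifP; rewrite // setIC.
subst kl.
have [_ _ a3] := plane_bounds _ pP; have [_ _ b3] := plane_bounds _ qP.
rewrite xpair_eqE eqxx /= => ab.
by apply/seteqP; split; apply: plane_same_axes; rewrite ?modn_small.
Qed.

Lemma intersection_linesE L : intersection_lines (arr_mu3 zeta) L <->
  exists2 t, t \in lines & L = (plane t.1 `&` plane t.2)%classic.
Proof.
split=> [[H [K [/arr_mu3E[p pP ->] /arr_mu3E[q qP ->] HK ->]]]|[t]].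
  have pq : p != q by apply/eqP => pq; apply: HK; rewrite pq.
  exists (line_code p q); last exact: line_codeE.
  rewrite mem_undup; apply/mapP; exists (p, q) => //.
  by rewrite mem_filter pq; apply/allpairsP; exists (p, q).
move=> /lines_planes[pP qP pq] ->; exists (plane t.1), (plane t.2).
split=> //; [by apply/arr_mu3E; exists t.1|by apply/arr_mu3E; exists t.2|].
by move/(plane_inj _ _ pP qP)/eqP; apply/negP.
Qed.

(** * The three counts and essentiality *)

Lemma arr_mu3_num_planes : num_planes (arr_mu3 zeta) = 12%N.
Proof. exact: card_set_seq arr_mu3E plane_signature planes_separated. Qed.

Lemma arr_mu3_num_lines : num_lines (arr_mu3 zeta) = 58%N.
Proof.
rewrite -size_lines; apply: card_set_seq intersection_linesE _ lines_separated.
move=> t u tP uP tu; apply/eq_in_map => s sP.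
by apply/idP/idP => /line_vec; [rewrite tu|rewrite -tu] => H;
  apply/line_vec => //; exact: H.
Qed.

Lemma arr_mu3_num_points : num_points (arr_mu3 zeta) = 43%N.
Proof.
rewrite -size_points; apply: card_set_seq intersection_pointsE _ points_separated.
move=> s t sP tP st; apply/eq_in_map => p pP.
by apply/idP/idP => /plane_vec; [rewrite st|rewrite -st] => H;
  apply/plane_vec => //; exact: H.
Qed.

Lemma arr_mu3_is_arrangement : is_arrangement (arr_mu3 zeta).
Proof.
split; last first.
  by move=> H /arr_mu3E[p pP ->]; exists (form p); split=> //; exact: form_neq0.
by rewrite (set_fset_map _ _ _ _ _ arr_mu3E).
Qed.

Lemma arr_mu3_essential : essential (arr_mu3 zeta).
Proof.
move=> g; exists [seq form p | p <- planes]; split.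
  move=> f /mapP[p pP ->]; exists (plane p); split; first by apply/arr_mu3E; exists p.
  by split=> //; exact: form_neq0.
set S := <<_>>%VS; suff -> : S = fullv by rewrite memvf.
apply: homcoord_span => i.
have formS p : p \in planes -> form p \in S by move=> pP; rewrite memv_span ?map_f.
have z1 : zeta - 1 != 0.
  by rewrite subr_eq0 -(expr0 zeta) -{1}[zeta]expr1 (eq_prim_root_expr zeta3).
have homS j k : (j < 2)%N -> (2 <= k < 4)%N ->
    homcoord F (inord j) \in S /\ homcoord F (inord k) \in S.
  move=> j2 /andP[k2 k4].
  have jkP a : (a < 3)%N -> (j, k, a) \in planes.
    by case: j k a j2 k2 k4 => [|[|]] // [|[|[|[|]]]] // [|[|[|]]].
  have kS : homcoord F (inord k) \in S.
    (* The difference (x_j - x_k) - (x_j - zeta x_k) is (zeta - 1) x_k, with an invertible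
       coefficient; adding x_k to x_j - x_k then recovers x_j. *)
    have := rpredB (formS _ (jkP 0%N isT)) (formS _ (jkP 1%N isT)).
    rewrite /form /= opprD opprK addrACA subrr add0r addrC -scalerBl.
    by rewrite expr0 expr1 rpredZeq (negPf z1).
  split=> //; have := rpredD (formS _ (jkP 0%N isT)) kS.
  by rewrite /form /= expr0 scale1r subrK.
rewrite -(inord_val i); have [i2|i2] := ltnP i 2.
  by have [] := homS i 2%N i2 isT.
by have [] := homS 0%N i isT; rewrite ?i2 ?ltn_ord.
Qed.

End ConcreteArrangement.

(** * Failure of Purdy's inequality over the complex numbers *)

Theorem theorem5p4 (R : realType) (zeta : R[i])
    (hzeta : 3.-primitive_root zeta) :
  is_arrangement (arr_mu3 zeta) /\
  essential (arr_mu3 zeta) /\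
  num_planes (arr_mu3 zeta) = 12%N /\
  num_lines (arr_mu3 zeta) = 58%N /\
  num_points (arr_mu3 zeta) = 43%N /\
  (num_points (arr_mu3 zeta))%:Z - (num_lines (arr_mu3 zeta))%:Z + 12 + 2
    = -1 :> int /\
  ~ purdy_inequality (arr_mu3 zeta).
Proof.
have nP := arr_mu3_num_planes _ _ hzeta; have nL := arr_mu3_num_lines _ _ hzeta.
have nV := arr_mu3_num_points _ _ hzeta.
split; first exact: arr_mu3_is_arrangement.
split; first exact: arr_mu3_essential.
by rewrite /purdy_inequality nP nL nV.
Qed.
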